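(* For any integers $n, k \geq 1$, let $\ell_{n,k} = \sum_{\pi \in \mathfrak{L}_n} |\mathcal{O}^{-1}_{\mathrm{CPF}_n(k)}(\pi)|$, where $\mathfrak{L}_n \subseteq \mathfrak{S}_n$ is the set of layered permutations of length $n$, and let $f_{n,k} =|\mathcal{O}^{-1}_{\mathrm{CPF}_n(k)}(w_0)|$ denote the size of the fiber of the longest word $w_0=(n,n-1,\dots,2,1) \in \mathfrak{S}_n$ under the $k$-cascading parking rule. Set $\ell_{0,k}=1$ and $f_{0,k}=1$. Then: 1. For any $n \geq 2$ we have $$\ell_{n,k} = \sum_{i=1}^n f_{i,k}\, \ell_{n-i,k},$$ where $\ell_{0,k} = 1$ and $\ell_{1,k} = 1$. Therefore, $\{\ell_{n,k}\}_{n \geq 0}$ is the sequence of row sums of the convolution triangle of $\{f_{n,k}\}_{n \geq 1}$. 2. If $L_{k}(x) = \sum_{n \geq 0} \ell_{n,k} x^n$ and $F_{k}(x) = \sum_{n \geq 0} f_{n,k} x^n$, then $$L_k(x) = \frac{1}{2-F_k(x)}.$$ In particular: (a) $L_1(x) = \frac{1}{2-M(x)}$, where $M(x)=\sum_{n\ge 0}M_nx^n$ is the generating function of the Motzkin numbers $M_n=\sum_{\ell = 0}^{\lfloor n/2 \rfloor} \frac{1}{\ell + 1} \binom{n}{2 \ell}\binom{2\ell}{\ell}$; (b) the sequence whose terms of index $n=0$ and $n=1$ are both $1$ and whose $n$th term for $n\ge 2$ is $\ell_{n,n-1}$ (i.e. taking $k=n-1$) has generating function $\frac{1}{2-C(x)}$,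 where $C(x)=\sum_{n\ge0}\frac{1}{n+1}\binom{2n}{n}x^n$ is the generating function of the Catalan numbers.
   Context: There are $n$ cars, numbered $1,\dots,n$, entering in this order a one-way street with parking spots $1,2,\dots,n$ (in this order along the street). A preference tuple is $\alpha=(a_1,\dots,a_n)\in[n]^n$, where $[n]=\{1,\dots,n\}$ and $a_i$ is the preferred spot of car $i$. $k$-cascading parking rule ($k\ge 0$ an integer): when car $i$ enters, if spot $a_i$ is available it parks there. If spot $a_i$ is occupied and $k\geq 1$, car $i$ parks in spot $a_i$ and bumps the car occupying it out of it; the bumped car attempts to park in the spot immediately after the one it was bumped from: if that spot is available it parks there; if it is occupied and fewer than $k$ bumps have occurred since the arrival of car $i$, it parks there and bumps the car occupying it, which then attempts to park in the next spot in the same way, and so on. Once $k$ bumps have occurred, the last displaced car continues down the street without bumping any more cars and parks in the first unoccupied spot it encounters, if any. A car that runs past spot $n$ fails to park. For $k=0$ no bumping occurs and a car finding its preferred spot occupied continues forward to the first available spot. $\alpha$ is a $k$-cascading parking function if all cars can park under this rule; $\mathrm{CPF}_n(k)$ is the set of $k$-cascading parking functions of length $n$. The outcome of $\alpha\in\mathrm{CPF}_n(k)$ is the permutation $\pi=(\pi_1,\dots,\pi_n)\in\mathfrak{S}_n$ (permutations of $[n]$, one-line notation) such that $\pi_i=j$ means that car $j$ is parked in spot $i$ at the end of the process. $\mathcal{O}^{-1}_{\mathrm{CPF}_n(k)}(\pi)$ denotes the set of $\alpha\in\mathrm{CPF}_n(k)$ whose outcome (under the $k$-cascading rule) is $\pi$.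 The direct sum of $\sigma\in\mathfrak{S}_p$ and $\tau\in\mathfrak{S}_q$ is the permutation $\sigma\oplus\tau\in\mathfrak{S}_{p+q}$ with $(\sigma\oplus\tau)(i)=\sigma(i)$ for $i\le p$ and $(\sigma\oplus\tau)(i)=p+\tau(i-p)$ for $p+1\le i\le p+q$. A permutation is layered if it is a direct sum of (one or more, non-empty) decreasing permutations $(m,m-1,\dots,1)$. The convolution triangle of a sequence $\{f_n\}_{n\ge1}$ is the array $T(n,m)$, $0\le m\le n$, where $T(n,m)$ is the coefficient of $x^n$ in $\left(\sum_{j\ge1}f_jx^j\right)^m$; the row sums are $\sum_{m=0}^nT(n,m)$. *)

(* Defs.v *)
From HB Require Import structures.
From mathcomp Require Import all_boot all_order all_fingroup all_algebra.
From mathcomp Require Import boolp.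

Set Implicit Arguments.
Unset Strict Implicit.
Unset Printing Implicit Defensive.

Import GRing.Theory.
Local Open Scope ring_scope.

(* Formal power series R[[x]]; a n is the coefficient of x^n in a. Equality and
   choice on this type come from the classical axioms of boolp. *)

Record fps (R : comUnitRingType) := Fps { coef_fps :> nat -> R }.

Arguments Fps {R}.

HB.instance Definition _ (R : comUnitRingType) := gen_eqMixin (fps R).
HB.instance Definition _ (R : comUnitRingType) := gen_choiceMixin (fps R).

Definition fps_zero (R : comUnitRingType) : fps R := Fps (fun=> 0).
Definition fps_opp (R : comUnitRingType) (a : fps R) : fps R :=
  Fps (fun n => - a n).
Definition fps_add (R : comUnitRingType) (a b : fps R) : fps R :=
  Fps (fun n => a n + b n).
Definition fps_one (R : comUnitRingType) : fps R := Fps (fun n => (n == 0%N)%:R).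
Definition fps_mul (R : comUnitRingType) (a b : fps R) : fps R :=
  Fps (fun n => \sum_(i < n.+1) a i * b (n - i)%N).

Lemma fpsP (R : comUnitRingType) (a b : fps R) : a =1 b <-> a = b.
Proof. by split=> [|-> //]; case: a b => [a] [b] /= /funext ->. Qed.

Fact fps_addA R : associative (@fps_add R).
Proof. by move=> a b c; apply/fpsP => n; exact: addrA. Qed.
Fact fps_addC R : commutative (@fps_add R).
Proof. by move=> a b; apply/fpsP => n; exact: addrC. Qed.
Fact fps_add0 R : left_id (@fps_zero R) (@fps_add R).
Proof. by move=> a; apply/fpsP => n; exact: add0r. Qed.
Fact fps_addN R : left_inverse (@fps_zero R) (@fps_opp R) (@fps_add R).
Proof. by move=> a; apply/fpsP => n; exact: addNr. Qed.

HB.instance Definition _ (R : comUnitRingType) := GRing.isZmodule.Build (fps R)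
  (@fps_addA R) (@fps_addC R) (@fps_add0 R) (@fps_addN R).

Definition trunc_fps (R : comUnitRingType) (N : nat) (a : fps R) : {poly R} :=
  \poly_(i < N) a i.

Lemma coef_trunc_fps_mul (R : comUnitRingType) N (a b : fps R) n : (n < N)%N ->
  fps_mul a b n = (trunc_fps N a * trunc_fps N b)`_n.
Proof.
move=> ltnN; rewrite coefM; apply: eq_bigr => i _; rewrite !coef_poly.
by rewrite (leq_ltn_trans (leq_ord i) ltnN) (leq_ltn_trans (leq_subr i n) ltnN).
Qed.

Fact fps_mulA R : associative (@fps_mul R).
Proof.
move=> a b c; apply/fpsP => n.
have truncE (d : fps R) i : (i <= n)%N -> d i = (trunc_fps n.+1 d)`_i.
  by move=> lein; rewrite coef_poly ltnS lein.
transitivity ((trunc_fps n.+1 a * (trunc_fps n.+1 b * trunc_fps n.+1 c))`_n).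
  rewrite coefM; apply: eq_bigr => i _.
  rewrite -truncE ?leq_ord // -coef_trunc_fps_mul // ltnS.
  exact: leq_subr.
rewrite mulrA coefM; apply: eq_bigr => i _.
by rewrite -truncE ?leq_subr // -coef_trunc_fps_mul.
Qed.

Fact fps_mulC R : commutative (@fps_mul R).
Proof.
by move=> a b; apply/fpsP => n; rewrite !(@coef_trunc_fps_mul _ n.+1) // mulrC.
Qed.

Fact fps_mul1 R : left_id (@fps_one R) (@fps_mul R).
Proof.
move=> a; apply/fpsP => n; rewrite /= big_ord_recl mul1r subn0.
by rewrite big1 ?addr0 // => i _; rewrite mul0r.
Qed.

Fact fps_mulDl R : left_distributive (@fps_mul R) +%R.
Proof.
move=> a b c; apply/fpsP => n /=.
by rewrite -big_split; apply: eq_bigr => i _; rewrite mulrDl.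
Qed.

Fact fps_one_neq0 R : fps_one R != 0.
Proof.
by apply/eqP => /(congr1 (fun a : fps R => a 0%N)) /eqP; rewrite oner_eq0.
Qed.

HB.instance Definition _ (R : comUnitRingType) :=
  GRing.Zmodule_isComNzRing.Build (fps R) (@fps_mulA R) (@fps_mulC R)
    (@fps_mul1 R) (@fps_mulDl R) (@fps_one_neq0 R).

(* The first n coefficients of 1/a, from the recurrence
   b_0 = 1/a_0, b_{n+1} = - (1/a_0) (a_1 b_n + ... + a_{n+1} b_0). *)
Fixpoint fps_inv_seq (R : comUnitRingType) (a : fps R) (n : nat) : seq R :=
  if n is n'.+1 then
    let b := fps_inv_seq a n' in
    rcons b (if n' is m.+1 then
               - (a 0%N)^-1 * \sum_(i < m.+1) a i.+1 * b`_(m - i)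
             else (a 0%N)^-1)
  else [::].

Definition fps_unit (R : comUnitRingType) : pred (fps R) :=
  fun a => a 0%N \is a GRing.unit.

Definition fps_inv (R : comUnitRingType) (a : fps R) : fps R :=
  if fps_unit a then Fps (fun n => (fps_inv_seq a n.+1)`_n) else a.

Lemma size_fps_inv_seq (R : comUnitRingType) (a : fps R) n :
  size (fps_inv_seq a n) = n.
Proof. by elim: n => //= n IHn; rewrite size_rcons IHn. Qed.

Lemma nth_fps_inv_seq (R : comUnitRingType) (a : fps R) n i : (i < n)%N ->
  (fps_inv_seq a n)`_i = (fps_inv_seq a i.+1)`_i.
Proof.
elim: n => // n IHn; rewrite ltnS leq_eqVlt => /predU1P[-> // | ltin].
by rewrite -IHn //= nth_rcons size_fps_inv_seq ltin.
Qed.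

Fact fps_mulV R : {in @fps_unit R, left_inverse 1 (@fps_inv R) *%R}.
Proof.
move=> a ua; have ua0 : a 0%N \is a GRing.unit by exact: ua.
rewrite /fps_inv /fps_unit ua0 mulrC; apply/fpsP => -[|m].
  by rewrite [LHS]big_ord1 /= divrr.
rewrite [LHS]big_ord_recl /= subn0.
rewrite !nth_rcons size_rcons size_fps_inv_seq ltnn eqxx mulrA mulrN divrr //.
rewrite mulN1r; apply/eqP; rewrite addrC subr_eq0; apply/eqP.
apply: eq_bigr => i _; rewrite /bump leq0n add1n subSS; congr (_ * _).
by have := @nth_fps_inv_seq R a m.+1 (m - i) (leq_subr i m); rewrite /= => ->.
Qed.

Fact fps_unitP R (a b : fps R) : b * a = 1 -> fps_unit a.
Proof.
move=> /(congr1 (fun c : fps R => c 0%N)); rewrite [LHS]big_ord1 subn0 /= => ba1.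
by apply/unitrPr; exists (b 0%N); rewrite mulrC.
Qed.

Fact fps_inv_out R : {in [predC @fps_unit R], @fps_inv R =1 id}.
Proof. by move=> a /negPf; rewrite /fps_inv -topredE /= => ->. Qed.

HB.instance Definition _ (R : comUnitRingType) :=
  GRing.ComNzRing_hasMulInverse.Build (fps R)
    (@fps_mulV R) (@fps_unitP R) (@fps_inv_out R).

Definition gen_fun (u : nat -> rat) : fps rat := Fps u.

(* T(n, m) is the coefficient of x^n in (sum_(j >= 1) u_j x^j)^m. *)
Definition convolution_triangle (u : nat -> rat) (n m : nat) : rat :=
  (gen_fun (fun j => if j is 0 then 0 else u j) ^+ m) n.

Definition row_sum (T : nat -> nat -> rat) (n : nat) : rat :=
  \sum_(m < n.+1) T n m.

Definition motzkin (n : nat) : rat :=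
  \sum_(l < n./2.+1) l.+1%:R^-1 * 'C(n, l.*2)%:R * 'C(l.*2, l)%:R.

Definition catalan (n : nat) : rat := n.+1%:R^-1 * 'C(n.*2, n)%:R.

(* Cars, spots and the letters of permutations in S_n are numbered from 0, i.e.
   they are the elements of 'I_n; enum 'I_n lists them in increasing order. *)

(* Car c attempts to park in the first spot of the stretch of street s (which
   ends at the last spot), b being the number of bumps still allowed.
   An empty spot is None, a spot occupied by d is Some d; the result is the
   new content of s, or None if some car runs past the end of the street. *)
Fixpoint park_from (C : Type) (b : nat) (c : C) (s : seq (option C)) :
    option (seq (option C)) :=
  match s with
  | [::] => None
  | None :: s' => Some (Some c :: s')
  | Some d :: s' =>
      if b is b'.+1 then omap (cons (Some c)) (park_from b' d s')
      else omap (cons (Some d)) (park_from 0 c s')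
  end.

Definition arrive (C : Type) (k : nat) (c : C) (a : nat)
    (s : seq (option C)) : option (seq (option C)) :=
  omap (cat (take a s)) (park_from k c (drop a s)).

(* The final street (its i-th entry is the content of spot i), or None if some
   car fails to park. *)
Definition park_all (n k : nat) (alpha : n.-tuple 'I_n) :
    option (seq (option 'I_n)) :=
  foldl (fun st i => obind (arrive k i (tnth alpha i)) st)
        (Some (nseq n None)) (enum 'I_n).

Definition CPF (n k : nat) : {set n.-tuple 'I_n} :=
  [set alpha | isSome (park_all k alpha)].

Definition has_outcome (n k : nat) (alpha : n.-tuple 'I_n) (pi : 'S_n) : bool :=
  park_all k alpha == Some [seq Some (pi i) | i <- enum 'I_n].

Definition outcome_fiber (n k : nat) (pi : 'S_n) : {set n.-tuple 'I_n} :=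
  [set alpha in CPF n k | has_outcome k alpha pi].

Definition decreasing_perm (n : nat) : 'S_n := perm (@rev_ord_inj n).

Definition dsum_fun (p q : nat) (s : 'S_p) (t : 'S_q) (i : 'I_(p + q)) :
    'I_(p + q) :=
  match split i with
  | inl j => lshift q (s j)
  | inr j => rshift p (t j)
  end.

Fact dsum_fun_inj p q (s : 'S_p) (t : 'S_q) : injective (dsum_fun s t).
Proof.
move=> i j; rewrite /dsum_fun -{2}(splitK i) -{2}(splitK j).
case: (split i) (split j) => [i'|i'] [j'|j'] /= /eqP.
- by rewrite eq_lshift => /eqP/perm_inj ->.
- by rewrite eq_lrshift.
- by rewrite eq_rlshift.
- by rewrite eq_rshift => /eqP/perm_inj ->.
Qed.

Definition dsum_perm (p q : nat) (s : 'S_p) (t : 'S_q) : 'S_(p + q) :=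
  perm (@dsum_fun_inj p q s t).

Fixpoint dsum_decreasing (ms : seq nat) : 'S_(sumn ms) :=
  match ms return 'S_(sumn ms) with
  | [::] => 1%g
  | m :: ms' => dsum_perm (decreasing_perm m) (dsum_decreasing ms')
  end.

Definition layered (n : nat) (pi : 'S_n) : Prop :=
  exists ms : seq nat, [/\ ms != [::], all (leq 1) ms &
    exists sum_ms : sumn ms = n, pi = cast_perm sum_ms (dsum_decreasing ms)].

(* The value at n = 0 is the convention of the recurrence. *)
Definition layered_count (k n : nat) : nat :=
  if n is 0 then 1%N
  else (\sum_(pi : 'S_n | `[< layered pi >]) #|outcome_fiber k pi|)%N.

Definition w0_fiber_count (k n : nat) : nat :=
  if n is 0 then 1%N else #|outcome_fiber k (decreasing_perm n)|.

(* Main.v *)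
Require Import Defs.
From mathcomp Require Import all_boot all_order all_fingroup all_algebra.
From mathcomp Require Import boolp.
From mathcomp Require Import ring zify.

(** Since bumping is allowed, a car is in its preferred spot right after its
    arrival, and cars only move forward.  Two consequences make parts of the
    street independent.  If none of the later cars ends in an initial stretch of
    the street, none of them entered it, as the last one to do so would still be
    there, and that stretch was complete before ([npaths_dsum]); and no car has
    passed a spot which is still empty ([npaths_gap]).  The first fact makes the size of the fiber multiplicative
    for direct sums ([weight_cat]).  Layered permutations are the direct sums of
    decreasing permutations, in exactly one way for each composition of [n], so
    [layered_count k n] is the sum over the compositions of [n] of the products
    of the numbers [w0_fiber_count k i] over the parts [i]
    ([layered_count_compositions]).  Splitting off the first part gives the
    recurrence, which for power series reads [L = 1 + (F - 1) * L]; the row sums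
    of the convolution triangle are the coefficients of the geometric series
    [1 / (1 - (F - 1))].

    For the two special cases one looks at the arrival of the last car in the
    first spot, when the final street is decreasing.  Just before, one spot is
    empty, and the two sides of it are independent by [npaths_gap].  If enough
    bumps are allowed, both sides are decreasing, which gives the Catalan
    recurrence ([weight_decr_rec_large]).  If one bump is allowed, the car in
    the first spot jumps to the empty spot, so that the left side was that car
    followed by a decreasing word, a direct sum again; this gives the Motzkin
    recurrence ([weight_decr_rec_one]).  It remains to see that the closed forms
    satisfy these recurrences ([catalan_convolution], [motzkin_rec]). *)

Set Implicit Arguments.
Unset Strict Implicit.
Unset Printing Implicit Defensive.

Import GRing.Theory Num.Theory.

(** * Arrivals and sequences of arrivals *)

(** The parking process from an arbitrary street [s], so that it can be cut
    anywhere: the cars [cs] arrive in this order, with the preferences [a].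
    Lists of different lengths count as a failure, which spares every later
    statement a hypothesis on lengths. *)
Fixpoint run (C : Type) (k : nat) (s : seq (option C)) (cs : seq C)
    (a : seq nat) : option (seq (option C)) :=
  match cs, a with
  | [::], [::] => Some s
  | c :: cs', x :: a' => obind (fun s' => run k s' cs' a') (arrive k c x s)
  | _, _ => None
  end.

Lemma arrive0 (C : eqType) k (c : C) s : arrive k c 0 s = park_from k c s.
Proof. by rewrite /arrive take0 drop0; case: park_from. Qed.

Lemma arriveS (C : eqType) k (c : C) a x s :
  arrive k c a.+1 (x :: s) = omap (cons x) (arrive k c a s).
Proof. by rewrite /arrive /=; case: park_from. Qed.

Lemma arrive_nil (C : eqType) k (c : C) a : arrive k c a [::] = None.
Proof. by rewrite /arrive; case: a. Qed.

Lemma park_from_size_count (C : eqType) b (c : C) s t :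
  park_from b c s = Some t ->
  size t = size s /\ count isSome t = (count isSome s).+1.
Proof.
elim: s b c t => [|[d|] s IHs] b c t //=; last by case=> <-.
by case: b => [|b]; case E: park_from => [u|] //= [<-] /=;
  have [-> ->] := IHs _ _ _ E.
Qed.

Lemma arrive_size_count (C : eqType) k (c : C) a s t :
  arrive k c a s = Some t ->
  [/\ a < size s, size t = size s & count isSome t = (count isSome s).+1].
Proof.
elim: a s t => [|a IHa] [|x s] t; rewrite ?arrive_nil //.
  by rewrite arrive0 => /park_from_size_count[sz_t ct_t]; split.
rewrite arriveS; case E: arrive => [u|] //= [<-] /=.
by rewrite ltnS; have [-> -> ->] := IHa _ _ E; rewrite addnS.
Qed.

Lemma park_from_head (C : eqType) b (c : C) s t : park_from b c s = Some t ->
  exists d t', t = Some d :: t' /\ (0 < b -> d = c).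
Proof.
case: s => [|[d|] s] //=; last by case=> <-; exists c, s.
by case: b => [|b]; case E: park_from => [u|] //= [<-];
  [exists d, u | exists c, u].
Qed.

Lemma arrive_mem (C : eqType) k (c : C) a s t : 0 < k ->
  arrive k c a s = Some t -> Some c \in t.
Proof.
move=> k_gt0; elim: a s t => [|a IHa] [|x s] t; rewrite ?arrive_nil //.
  rewrite arrive0 => /park_from_head[d [t' [-> /(_ k_gt0) ->]]].
  exact: mem_head.
rewrite arriveS; case E: arrive => [u|] //= [<-].
by rewrite inE (IHa _ _ E) orbT.
Qed.

(** As bumping is allowed ([0 < k]), a car is in its preferred spot right after
    its arrival.  Hence if it is not in the part [t1] of the street then, it
    entered beyond that part, and cars only move forward: [t1] was not
    touched. *)
Lemma arrive_peel_right (C : eqType) k (c : C) a s t1 t2 : 0 < k ->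
    Some c \notin t1 -> arrive k c a s = Some (t1 ++ t2) ->
  exists b s2, [/\ a = size t1 + b, s = t1 ++ s2 & arrive k c b s2 = Some t2].
Proof.
move=> k_gt0; elim: t1 a s => [|y t1 IHt] a s /=; first by exists a, s.
rewrite inE negb_or => /andP[c_y c_t1].
case: a s => [|a] [|x s]; rewrite ?arrive_nil //.
  rewrite arrive0 => /park_from_head[d [t' [[eq_y _] /(_ k_gt0) eq_d]]].
  by rewrite eq_y eq_d eqxx in c_y.
rewrite arriveS; case E: arrive => [u|] //= [<- eq_u].
rewrite eq_u in E; have [b [s2 [-> -> <-]]] := IHt _ _ c_t1 E.
by exists b, s2.
Qed.

(** A spot that is still empty was not passed by any moving car, so what lies
    beyond it was not touched. *)
Lemma park_from_peel_left (C : eqType) b (c : C) s t1 t2 :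
  park_from b c s = Some (t1 ++ None :: t2) ->
  exists s1, s = s1 ++ None :: t2 /\ park_from b c s1 = Some t1.
Proof.
elim: s b c t1 => [|[d|] s IHs] b c [|y t1] //=.
- by case: b => [|b]; case: park_from.
- by case: b => [|b]; case E: park_from => [u|] //= [<- eq_u];
    rewrite eq_u in E; have [s1 [-> Es1]] := IHs _ _ _ E;
    exists (Some d :: s1); rewrite /= Es1.
- by case=> <- ->; exists (None :: t1).
Qed.

Lemma arrive_peel_left (C : eqType) k (c : C) a s t1 t2 : 0 < k ->
    Some c \notin t2 -> arrive k c a s = Some (t1 ++ None :: t2) ->
  exists s1, s = s1 ++ None :: t2 /\ arrive k c a s1 = Some t1.
Proof.
move=> k_gt0 c_t2; elim: a s t1 => [|a IHa] s t1.
  by rewrite arrive0 => /park_from_peel_left[s1]; rewrite -arrive0; exists s1.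
case: s => [|x s]; rewrite ?arrive_nil // arriveS.
case E: arrive => [u|] //=; case: t1 => [|y t1] /= [-> eq_u].
  by rewrite eq_u in E; rewrite (arrive_mem k_gt0 E) in c_t2.
rewrite eq_u in E; have [s1 [-> Es1]] := IHa _ _ E.
by exists (y :: s1); rewrite arriveS Es1.
Qed.

Lemma arrive_catr (C : eqType) k (c : C) a s1 s2 :
  arrive k c (size s1 + a) (s1 ++ s2) = omap (cat s1) (arrive k c a s2).
Proof.
elim: s1 => [|x s1 IHs] /=; first by case: arrive.
by rewrite arriveS IHs; case: arrive.
Qed.

Lemma park_from_catl (C : eqType) b (c : C) s1 s2 t1 :
  park_from b c s1 = Some t1 -> park_from b c (s1 ++ s2) = Some (t1 ++ s2).
Proof.
elim: s1 b c t1 => [|[d|] s1 IHs] b c t1 //=; last by case=> <-.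
by case: b => [|b]; case E: park_from => [u|] //= [<-]; rewrite (IHs _ _ _ E).
Qed.

Lemma arrive_catl (C : eqType) k (c : C) a s1 s2 t1 :
  arrive k c a s1 = Some t1 -> arrive k c a (s1 ++ s2) = Some (t1 ++ s2).
Proof.
elim: a s1 t1 => [|a IHa] s1 t1.
  by rewrite !arrive0; exact: park_from_catl.
case: s1 => [|x s1]; rewrite ?arrive_nil // !arriveS.
by case E: arrive => [u|] //= [<-]; rewrite (IHa _ _ E).
Qed.

Lemma run_size_count (C : eqType) k s (cs : seq C) a t :
  run k s cs a = Some t ->
  [/\ size a = size cs, all (gtn (size s)) a, size t = size s
    & count isSome t = count isSome s + size cs].
Proof.
elim: cs s a => [|c cs IHcs] s [|x a] //=; first by case=> ->; rewrite addn0.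
case E: arrive => [s'|] //= /IHcs[-> + -> ->].
by have [-> -> ->] := arrive_size_count E; rewrite addSnnS.
Qed.

Lemma count_isSome_eq0 (C : eqType) (s : seq (option C)) :
  count isSome s = 0 -> s = nseq (size s) None.
Proof. by elim: s => [|[c|] s IHs] //= /IHs {1}->. Qed.

(** Each arrival occupies one more spot, so that as many cars as there are
    spots can only fill a street that was empty. *)
Lemma run_from_empty (C : eqType) k s (cs : seq C) a w : size cs = size w ->
  run k s cs a = Some (map some w) -> s = nseq (size w) None.
Proof.
move=> eq_sz /run_size_count[_ _]; rewrite size_map => -> eq_ct.
apply: count_isSome_eq0; move: eq_ct; rewrite count_map.
rewrite (eq_count (a2 := predT)) // count_predT eq_sz; lia.
Qed.

Lemma run_cat (C : eqType) k s (cs1 cs2 : seq C) a t :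
  run k s (cs1 ++ cs2) a = Some t <->
  exists a1 a2 m,
    [/\ a = a1 ++ a2, run k s cs1 a1 = Some m & run k m cs2 a2 = Some t].
Proof.
split.
  elim: cs1 s a => [|c cs1 IHcs] s a /=; first by exists [::], a, s.
  case: a => [|x a] //; case E: arrive => [s'|] //= /IHcs.
  case=> a1 [a2 [m [-> E1 E2]]].
  by exists (x :: a1), a2, m; rewrite /= E.
case=> a1 [a2 [m [-> E1 E2]]].
elim: cs1 s a1 E1 => [|c cs1 IHcs] s [|x a1] //=; first by case=> ->.
by case E: arrive => [s'|] //= /IHcs.
Qed.

(** The two peeling principles pass from one arrival to any sequence of
    arrivals; they are what makes parts of the street independent. *)
Lemma run_peel_right (C : eqType) k s (cs : seq C) a t1 t2 : 0 < k ->
    all (fun c => Some c \notin t1) cs -> run k s cs a = Some (t1 ++ t2) ->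
  exists b s2, [/\ a = map (addn (size t1)) b, s = t1 ++ s2
                 & run k s2 cs b = Some t2].
Proof.
move=> k_gt0; elim: cs s a => [|c cs IHcs] s [|x a] //=.
  by move=> _ [->]; exists [::], t2.
case/andP=> c_t1 cs_t1; case E: arrive => [s'|] //=.
case/(IHcs _ _ cs_t1) => b [s2 [-> eq_s' run_b]]; rewrite eq_s' in E.
have [y [s3 [-> -> E3]]] := arrive_peel_right k_gt0 c_t1 E.
by exists (y :: b), s3; rewrite /= E3.
Qed.

Lemma run_catr (C : eqType) k s1 s2 (cs : seq C) a :
  run k (s1 ++ s2) cs (map (addn (size s1)) a) = omap (cat s1) (run k s2 cs a).
Proof.
elim: cs a s2 => [|c cs IHcs] [|x a] s2 //=.
by rewrite arrive_catr; case: arrive => /=.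
Qed.

Lemma run_peel_left (C : eqType) k s (cs : seq C) a t1 t2 : 0 < k ->
    all (fun c => Some c \notin t2) cs ->
    run k s cs a = Some (t1 ++ None :: t2) ->
  exists s1, s = s1 ++ None :: t2 /\ run k s1 cs a = Some t1.
Proof.
move=> k_gt0; elim: cs s a => [|c cs IHcs] s [|x a] //=.
  by move=> _ [->]; exists t1.
case/andP=> c_t2 cs_t2; case E: arrive => [s'|] //=.
case/(IHcs _ _ cs_t2) => s1 [eq_s' run_b]; rewrite eq_s' in E.
have [s2 [-> E2]] := arrive_peel_left k_gt0 c_t2 E.
by exists s2; rewrite /= E2.
Qed.

Lemma run_catl (C : eqType) k s1 s2 (cs : seq C) a t1 :
  run k s1 cs a = Some t1 -> run k (s1 ++ s2) cs a = Some (t1 ++ s2).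
Proof.
elim: cs a s1 => [|c cs IHcs] [|x a] s1 //=; first by case=> ->.
by case E: arrive => [s'|] //= /IHcs <-; rewrite (arrive_catl _ E).
Qed.

(** * Counting preferences *)

Definition words (n m : nat) : seq (seq nat) :=
  [seq map val (x : m.-tuple 'I_n) | x <- enum {: m.-tuple 'I_n}].

Lemma words_uniq n m : uniq (words n m).
Proof.
rewrite map_inj_uniq ?enum_uniq // => x y eq_xy; apply: val_inj.
exact: (inj_map val_inj).
Qed.

Lemma mem_words n m a : (a \in words n m) = (size a == m) && all (gtn n) a.
Proof.
apply/mapP/andP => [[x _ ->] | [/eqP sz_a /allP lt_a]].
  rewrite size_map size_tuple eqxx; split=> //.
  by apply/allP => _ /mapP[i _ ->] /=.
case: n lt_a => [|n] lt_a.
  case: a sz_a lt_a => [|x a] sz_a lt_a; last by have:= lt_a x (mem_head _ _).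
  by case: m / sz_a; exists [tuple]; rewrite ?mem_enum.
have sz_b : size (map (@inord n) a) == m by rewrite size_map sz_a.
exists (Tuple sz_b); rewrite ?mem_enum //= -map_comp map_id_in // => x /lt_a.
exact: inordK.
Qed.

(** The preference lists that lead from the street [s] to the street [t].  No
    list is lost by taking the entries below the number of spots, since a car
    that prefers a spot beyond the end of the street fails to park. *)
Definition paths (C : eqType) k s (cs : seq C) t : seq (seq nat) :=
  [seq a <- words (size s) (size cs) | run k s cs a == Some t].

Definition npaths (C : eqType) k s (cs : seq C) t := size (paths k s cs t).

Lemma paths_uniq (C : eqType) k s (cs : seq C) t : uniq (paths k s cs t).
Proof. by rewrite filter_uniq ?words_uniq. Qed.

Lemma mem_paths (C : eqType) k s (cs : seq C) t a :
  (a \in paths k s cs t) = (run k s cs a == Some t).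
Proof.
rewrite mem_filter; case: eqP => //= /run_size_count[sz_a lt_a _ _].
by rewrite mem_words sz_a eqxx.
Qed.

(** Preference lists are sorted by the street [m] reached between the cars
    [cs1] and the cars [cs2], as in a product of transfer matrices. *)
Lemma npaths_mid (C : eqType) k s (cs1 cs2 : seq C) t
    (ms : seq (seq (option C))) :
    uniq ms ->
    (forall a1 a2 m, run k s cs1 a1 = Some m -> run k m cs2 a2 = Some t ->
       m \in ms) ->
  npaths k s (cs1 ++ cs2) t =
    \sum_(m <- ms) npaths k s cs1 m * npaths k m cs2 t.
Proof.
move=> ms_uniq msP.
pose P m := [seq a1 ++ a2 | a1 <- paths k s cs1 m, a2 <- paths k m cs2 t].
have PP m z : z \in P m -> exists a1 a2,
    [/\ z = a1 ++ a2, run k s cs1 a1 = Some m & run k m cs2 a2 = Some t].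
  case/allpairsP=> -[a1 a2] /= []; rewrite !mem_paths => /eqP E1 /eqP E2 ->.
  by exists a1, a2.
have perm_P : perm_eq (paths k s (cs1 ++ cs2) t) [seq z | m <- ms, z <- P m].
  apply: uniq_perm; first exact: paths_uniq.
    apply: allpairs_uniq_dep => //= [m _|].
      apply: allpairs_uniq; try exact: paths_uniq.
      move=> [a1 a2] [b1 b2] /allpairsP[[x1 x2] /= [+ _ [-> ->]]].
      move=> + /allpairsP[[y1 y2] /= [+ _ [-> ->]]].
      rewrite !mem_paths => /eqP/run_size_count[sz_x _ _ _].
      move=> /eqP/run_size_count[sz_y _ _ _] /eqP.
      by rewrite eqseq_cat ?sz_x ?sz_y // => /andP[/eqP-> /eqP->].
    (* The first [size cs1] preferences determine the street in between. *)
    move=> u v /allpairsPdep[m [z [_ /PP[a1 [a2 [-> E1 _]]] ->]]] /=.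
    move=> /allpairsPdep[m' [z' [_ /PP[b1 [b2 [-> E1' _]]] ->]]] /= eq_ab.
    have := eq_ab; move/eqP; rewrite eqseq_cat; last first.
      have [-> _ _ _] := run_size_count E1.
      by have [-> _ _ _] := run_size_count E1'.
    case/andP=> /eqP eq1 _; move: E1; rewrite eq1 E1' => -[->].
    by rewrite -eq_ab eq1.
  move=> a; rewrite mem_paths; apply/eqP/allpairsPdep => [|[m [z [_ + ->]]]].
    case/run_cat=> a1 [a2 [m [-> E1 E2]]]; exists m, (a1 ++ a2); split=> //.
      exact: msP E1 E2.
    by apply/allpairsP; exists (a1, a2); rewrite !mem_paths E1 E2.
  by case/PP=> a1 [a2 [-> E1 E2]]; apply/run_cat; exists a1, a2, m.
rewrite /npaths (perm_size perm_P) size_allpairs_dep sumnE big_map.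
by apply: eq_bigr => m _; rewrite size_allpairs.
Qed.

Lemma npaths_via (C : eqType) k s (cs1 cs2 : seq C) t m :
    (forall a1 a2 m', run k s cs1 a1 = Some m' -> run k m' cs2 a2 = Some t ->
       m' = m) ->
  npaths k s (cs1 ++ cs2) t = npaths k s cs1 m * npaths k m cs2 t.
Proof.
move=> mP; rewrite (@npaths_mid _ _ _ _ _ _ [:: m]) ?big_seq1 //.
by move=> a1 a2 m' E1 E2; rewrite inE (mP _ _ _ E1 E2).
Qed.

Lemma npaths_peel_right (C : eqType) k s (cs : seq C) t1 t2 : 0 < k ->
    all (fun c => Some c \notin t1) cs ->
  npaths k (t1 ++ s) cs (t1 ++ t2) = npaths k s cs t2.
Proof.
move=> k_gt0 cs_t1; rewrite /npaths -[RHS](size_map (map (addn (size t1)))).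
apply/perm_size/uniq_perm; first exact: paths_uniq.
  by rewrite map_inj_uniq ?paths_uniq //; apply: inj_map; exact: addnI.
move=> a; rewrite mem_paths; apply/eqP/mapP => [|[b + ->]]; last first.
  by rewrite mem_paths => /eqP E; rewrite run_catr E.
case/(run_peel_right k_gt0 cs_t1) => b [s2 [-> eq_s E]].
exists b => //; rewrite mem_paths.
by move/eqP: eq_s; rewrite eqseq_cat // eqxx => /eqP->; exact/eqP.
Qed.

Lemma npaths_peel_left (C : eqType) k s (cs : seq C) t1 t2 : 0 < k ->
    all (fun c => Some c \notin t2) cs ->
  npaths k (s ++ None :: t2) cs (t1 ++ None :: t2) = npaths k s cs t1.
Proof.
move=> k_gt0 cs_t2; apply/perm_size/uniq_perm; try exact: paths_uniq.
move=> a; rewrite !mem_paths; apply/eqP/eqP => [|/run_catl-> //].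
case/(run_peel_left k_gt0 cs_t2) => s1 [eq_s <-].
have sz_s : size s = size s1.
  by move/(congr1 size): eq_s; rewrite !size_cat /= => /addIn.
by move/eqP: eq_s; rewrite eqseq_cat // => /andP[/eqP->].
Qed.

(** Multiplicativity over a full initial stretch: if none of the later cars
    [cs2] ends up in the stretch [w1], they all enter beyond it; being as many
    as the remaining spots, they fill these from empty, so that just before
    their arrival [w1] is complete and the rest is empty. *)
Lemma npaths_dsum (C : eqType) k (cs1 cs2 w1 w2 : seq C) : 0 < k ->
    size cs2 = size w2 -> ~~ has (mem w1) cs2 ->
  npaths k (nseq (size w1 + size w2) None) (cs1 ++ cs2) (map some (w1 ++ w2)) =
    npaths k (nseq (size w1) None) cs1 (map some w1) *
    npaths k (nseq (size w2) None) cs2 (map some w2).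
Proof.
move=> k_gt0 sz2; rewrite -all_predC => cs2_w1.
have {}cs2_w1 : all (fun c => Some c \notin map some w1) cs2.
  apply: sub_all cs2_w1 => c /=; rewrite mem_map //; exact: Some_inj.
rewrite map_cat (@npaths_via _ _ _ _ _ _ (map some w1 ++ nseq (size w2) None)).
  rewrite npaths_peel_right //; congr (_ * _); case: (size w2) => [|q].
    by rewrite cats0 addn0.
  rewrite nseqD npaths_peel_left //.
  by apply/allP => c _; rewrite mem_nseq andbF.
move=> _ a2 m _ /(run_peel_right k_gt0 cs2_w1).
by case=> b [s2 [_ -> /run_from_empty->]].
Qed.

(** Multiplicativity around an empty spot: it separates the street, and if the
    later cars [csl] are not to its right, the right part is complete and the
    left part empty when they begin to arrive. *)
Lemma npaths_gap (C : eqType) k (csl csr wl wr : seq C) : 0 < k ->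
    size csl = size wl -> ~~ has (mem wr) csl ->
  npaths k (nseq (size wl + (size wr).+1) None) (csr ++ csl)
    (map some wl ++ None :: map some wr) =
    npaths k (nseq (size wl) None) csl (map some wl) *
    npaths k (nseq (size wr) None) csr (map some wr).
Proof.
move=> k_gt0 szl; rewrite -all_predC => csl_wr.
have {}csl_wr : all (fun c => Some c \notin map some wr) csl.
  apply: sub_all csl_wr => c /=; rewrite mem_map //; exact: Some_inj.
rewrite (@npaths_via _ _ _ _ _ _ (nseq (size wl) None ++ None :: map some wr)).
  rewrite npaths_peel_left // mulnC; congr (_ * _).
  rewrite nseqD -cat_rcons /= -cat_rcons npaths_peel_right //.
  by apply/allP => c _; rewrite mem_rcons inE mem_nseq andbF.
move=> _ a2 m _ /(run_peel_left k_gt0 csl_wr).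
by case=> s1 [-> /run_from_empty->].
Qed.

Lemma npaths_nil (C : eqType) k (s : seq (option C)) : npaths k s [::] s = 1.
Proof.
rewrite -[RHS]/(size [:: [::] : seq nat]); apply/perm_size/uniq_perm => //.
  exact: paths_uniq.
by move=> [|x a]; rewrite mem_paths //= eqxx.
Qed.

(** * Fibers of words *)

(** The rule compares no cars, so renaming them changes nothing. *)
Lemma arrive_map (C C' : eqType) (g : C -> C') k c a s :
  arrive k (g c) a (map (omap g) s) = omap (map (omap g)) (arrive k c a s).
Proof.
rewrite /arrive -map_take -map_drop.
suff -> b d u : park_from b (g d) (map (omap g) u) =
    omap (map (omap g)) (park_from b d u).
  by case: park_from => //= u; rewrite map_cat.
by elim: u b d => [|[x|] u IHu] [|b] d //=; rewrite IHu; case: park_from.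
Qed.

Lemma run_map (C C' : eqType) (g : C -> C') k s cs a :
  run k (map (omap g) s) (map g cs) a = omap (map (omap g)) (run k s cs a).
Proof.
elim: cs s a => [|c cs IHcs] s [|x a] //=.
by rewrite arrive_map; case: arrive => /=.
Qed.

Lemma npaths_map (C C' : eqType) (g : C -> C') k s cs t : injective g ->
  npaths k (map (omap g) s) (map g cs) (map (omap g) t) = npaths k s cs t.
Proof.
move=> g_inj; apply/perm_size/uniq_perm; try exact: paths_uniq.
move=> a; rewrite !mem_paths run_map; case: run => [u|] //=.
rewrite !(inj_eq Some_inj) (inj_eq (inj_map _)) //.
by case=> [x|] [y|] //= [/g_inj->].
Qed.

(** The size of the fiber of a permutation given by its word [w], the cars
    [0, 1, ...] arriving in increasing order. *)
Definition weight (k : nat) (w : seq nat) : nat :=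
  npaths k (nseq (size w) None) (iota 0 (size w)) (map some w).

Lemma npaths_shift k e n (w : seq nat) :
  npaths k (nseq n None) (iota e n) (map some (map (addn e) w)) =
    npaths k (nseq n None) (iota 0 n) (map some w).
Proof.
rewrite -[in LHS](addn0 e) iotaDl addn0.
by rewrite -[RHS](npaths_map k _ _ _ (@addnI e)) map_nseq -!map_comp.
Qed.

(** The word on the left is that of a direct sum: the cars of its second part
    are the last ones to arrive, and none of them ends up in the first part. *)
Lemma weight_cat k w1 w2 : 0 < k -> all (gtn (size w1)) w1 ->
  weight k (w1 ++ map (addn (size w1)) w2) = weight k w1 * weight k w2.
Proof.
move=> k_gt0 /allP w1_lt; rewrite /weight size_cat size_map iotaD.
have := @npaths_dsum _ k (iota 0 (size w1)) (iota (size w1) (size w2)) w1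
  (map (addn (size w1)) w2) k_gt0.
rewrite add0n size_map size_iota npaths_shift => -> //.
apply/hasPn => x; rewrite mem_iota => /andP[le_x _].
by apply: contraL le_x => /w1_lt /=; rewrite -ltnNge.
Qed.

(** * Fibers of the decreasing word *)

Definition decr (n : nat) : seq nat := rev (iota 0 n).

Lemma size_decr n : size (decr n) = n.
Proof. by rewrite size_rev size_iota. Qed.

Lemma mem_decr n x : (x \in decr n) = (x < n).
Proof. by rewrite mem_rev mem_iota. Qed.

Lemma decrD e j : decr (e + j) = map (addn e) (decr j) ++ decr e.
Proof. by rewrite /decr iotaD rev_cat map_rev -iotaDl addn0. Qed.

Lemma decrS n : decr n.+1 = n :: decr n.
Proof. by rewrite -addn1 decrD /= addn0. Qed.

(** If the last car [c] ends in the first spot, it preferred that spot, so the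
    count is a sum over the streets [m] from which this arrival leads to the
    given full street. *)
Lemma npaths_last (C : eqType) k s (cs : seq C) c (t : seq (option C))
    (ms : seq (seq (option C))) : 0 < k -> uniq ms ->
    Some c \notin t ->
    (forall m, (m \in ms) = (park_from k c m == Some (Some c :: t))) ->
  npaths k s (rcons cs c) (Some c :: t) = \sum_(m <- ms) npaths k s cs m.
Proof.
move=> k_gt0 ms_uniq c_t msP.
have first_spot x m : arrive k c x m = Some (Some c :: t) -> x = 0.
  case: x m => [|x] [|y m]; rewrite ?arrive_nil // arriveS.
  case E: arrive => [u|] //= [_ eq_u].
  by rewrite -eq_u (arrive_mem k_gt0 E) in c_t.
rewrite -cats1 (npaths_mid (ms := ms)) //
  => [|a1 [|x [|? ?]] m _] //=; last 2 first.
- case E: arrive => [u|] //= [eq_u]; rewrite eq_u in E.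
  by have x0 := first_spot _ _ E; rewrite x0 arrive0 in E; rewrite msP E.
- by case: arrive.
rewrite !big_seq; apply: eq_bigr => m; rewrite msP -arrive0 => /eqP m_t.
rewrite -[RHS]muln1; congr (_ * _).
rewrite -[RHS]/(size [:: [:: 0]]); apply/perm_size/uniq_perm => //.
  exact: paths_uniq.
move=> a; rewrite mem_paths inE; apply/eqP/eqP => [|->]; last by rewrite /= m_t.
case: a => [|x [|? ?]] //=; last by case: arrive.
case E: arrive => [u|] //= [eq_u]; rewrite eq_u in E.
by rewrite (first_spot _ _ E).
Qed.

(** The streets just before the last arrival that matter below: the oldest
    [e] cars are decreasing to the right of the empty spot, all the others are
    to its left. *)
Lemma npaths_decr_gap k e (wl : seq nat) : 0 < k ->
  npaths k (nseq (e + size wl).+1 None) (iota 0 (e + size wl))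
      (map some wl ++ None :: map some (decr e)) =
    npaths k (nseq (size wl) None) (iota e (size wl)) (map some wl) *
    weight k (decr e).
Proof.
move=> k_gt0; rewrite iotaD add0n /weight size_decr.
have := @npaths_gap _ k (iota e (size wl)) (iota 0 e) wl (decr e) k_gt0.
rewrite size_iota size_decr addnS [size wl + e]addnC => -> //.
apply/hasPn => x; rewrite mem_iota => /andP[le_x _].
by rewrite /= mem_decr -leqNgt.
Qed.

(** Without bumps the moving car lands on the empty spot and nobody else
    moves. *)
Lemma park_from0_full (C : eqType) (c : C) s t :
  park_from 0 c s = Some (map some t) ->
  exists u v, t = u ++ c :: v /\ s = map some u ++ None :: map some v.
Proof.
elim: s t => [|[d|] s IHs] [|x t] //=.
- by case: park_from.
- case E: park_from => [r|] //= [-> eq_r]; rewrite eq_r in E.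
  by have [u [v [-> ->]]] := IHs _ E; exists (x :: u), v.
- by case=> -> ->; exists [::], t.
Qed.

Lemma park_from0_gap (C : eqType) (c : C) u v :
  park_from 0 c (map some u ++ None :: v) = Some (map some u ++ Some c :: v).
Proof. by elim: u => //= x u ->. Qed.

(** If the bumps cannot be exhausted, each car up to the empty spot moves
    forward by one. *)
Lemma park_from_shift (C : eqType) b (c : C) s t : size s <= b.+1 ->
  park_from b c s = Some (map some t) <->
  exists u v, t = c :: u ++ v /\ s = map some u ++ None :: map some v.
Proof.
move=> le_s; split.
  elim: s b c t le_s => [|[d|] s IHs] b c [|x t] //=.
  - by case: b => [|b]; case: park_from.
  - case: b => [|b]; first by case: s {IHs}.
    rewrite ltnS => le_s; case E: park_from => [r|] //= [-> eq_r].
    rewrite eq_r in E; have [u [v [-> ->]]] := IHs _ _ _ le_s E.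
    by exists (d :: u), v.
  - by move=> _ [-> ->]; exists [::], t.
case=> u [v [-> eq_s]]; rewrite eq_s size_cat size_map /= addnS ltnS in le_s *.
elim: u b c le_s {eq_s} => [|d u IHu] b c //=.
by case: b => // b /IHu-> /=.
Qed.

Lemma big_iota0 (R : Type) (op : R -> R -> R) idx n (F : nat -> R) :
  \big[op/idx]_(i <- iota 0 n) F i = \big[op/idx]_(i < n) F i.
Proof. by rewrite -{1}[n]subn0 [LHS]big_mkord. Qed.

Lemma gap_index (C : eqType) (u : seq C) v :
  index None (map some u ++ None :: v) = size u.
Proof. by elim: u => //= x u ->. Qed.

(** Let [i] be the number of spots before the empty one when the last car
    arrives (in the first spot).  All cars before that spot are shifted by one,
    so the street was the decreasing word with an empty spot inserted after [i]
    letters, and the two sides are independent decreasing words.  This is the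
    recurrence of the Catalan numbers. *)
Lemma weight_decr_rec_large k n : 0 < k -> n <= k ->
  weight k (decr n.+1) =
    \sum_(i < n.+1) weight k (decr i) * weight k (decr (n - i)).
Proof.
move=> k_gt0 le_nk.
pose m j :=
  map some (map (addn (n - j)) (decr j)) ++ None :: map some (decr (n - j)).
rewrite {1}/weight size_decr -[in iota _ _]addn1 iotaD add0n cats1.
rewrite decrS map_cons.
rewrite (npaths_last _ _ (ms := map m (iota 0 n.+1))) //.
- rewrite big_map big_iota0.
  apply: eq_bigr => -[j /= lt_j] _; have le_j : j <= n by [].
  have := npaths_decr_gap (n - j) (map (addn (n - j)) (decr j)) k_gt0.
  rewrite size_map size_decr subnK // /m => ->.
  by rewrite npaths_shift /weight !size_decr.
- rewrite map_inj_in_uniq ?iota_uniq // => i j _ _.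
  by move/(congr1 (index None)); rewrite !gap_index !size_map !size_decr.
- by rewrite mem_map ?mem_decr ?ltnn //; exact: Some_inj.
move=> s; apply/mapP/eqP => [[j] | E].
  rewrite mem_iota => /= le_j ->.
  have le_m : size (m j) <= k.+1.
    by rewrite /m size_cat /= !size_map !size_decr; lia.
  apply/(park_from_shift n (n :: decr n) le_m).
  exists (map (addn (n - j)) (decr j)), (decr (n - j)); split=> //=.
  by rewrite -decrD subnK.
have sz_s : size s = n.+1.
  by have [<- _] := park_from_size_count E; rewrite /= size_map size_decr.
have le_s : size s <= k.+1 by rewrite sz_s.
have [u [v [[eq_uv] ->]]] := (park_from_shift n (n :: decr n) le_s).1 E.
have sz_uv : size u + size v = n by rewrite -size_cat -eq_uv size_decr.
exists (size u); first by rewrite mem_iota add0n ltnS -sz_uv leq_addr.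
have eq_n : n = n - size u + size u by rewrite -sz_uv addKn addnC.
move: eq_uv; rewrite {1}eq_n decrD => /eqP.
rewrite eqseq_cat; last by rewrite size_map size_decr.
by rewrite /m => /andP[/eqP-> /eqP->].
Qed.

(** With one bump, either the first spot was empty when the last car arrives,
    or it was taken by a car [e], which then jumps to the empty spot, namely
    its final one.  In the latter case the left side consisted of [e] followed
    by the decreasing word on the cars between [e] and the last one, that is,
    of the direct sum of a one-letter word and a decreasing word; the right
    side was the decreasing word of length [e].  This is the recurrence of the
    Motzkin numbers. *)
Lemma weight_decr_rec_one n :
  weight 1 (decr n.+1) = weight 1 (decr n) +
    \sum_(e < n) weight 1 (decr e) * weight 1 (decr (n.-1 - e)).
Proof.
pose wl e := e :: map (addn e.+1) (decr (n.-1 - e)).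
pose m e := map some (wl e) ++ None :: map some (decr e).
rewrite {1}/weight size_decr -[in iota _ _]addn1 iotaD add0n cats1.
rewrite decrS map_cons.
have size_wl e : e < n -> size (wl e) = n - e.
  by move=> lt_e; rewrite /= size_map size_decr; lia.
(* The final street, cut at the spot on which the jumping car [e] lands. *)
have decr_split e : e < n -> decr n = behead (wl e) ++ e :: decr e.
  by move=> lt_e; rewrite -decrS -decrD; congr decr; lia.
pose ms := (None :: map some (decr n)) :: map m (iota 0 n).
rewrite (npaths_last _ _ (ms := ms)) //.
- rewrite /ms big_cons big_map big_iota0; congr (_ + _).
    have := @npaths_decr_gap 1 n [::] isT; rewrite /= addn0 => ->.
    by rewrite npaths_nil mul1n.
  apply: eq_bigr => -[e /= lt_e] _.
  have := @npaths_decr_gap 1 e (wl e) isT; rewrite size_wl // subnKC 1?ltnW //.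
  rewrite /m => ->; rewrite mulnC; congr (_ * _).
  have -> : n - e = (n.-1 - e).+1 by lia.
  have := @npaths_dsum _ 1 [:: e] (iota e.+1 (n.-1 - e)) [:: e]
    (map (addn e.+1) (decr (n.-1 - e))) isT.
  rewrite size_iota size_map size_decr => ->; rewrite ?npaths_shift //.
    rewrite /weight size_decr -[RHS]mul1n; congr (_ * _).
    have := @npaths_last _ 1 [:: None] [::] e [::] [:: [:: None]] isT isT isT.
    rewrite /= => ->; first by rewrite big_seq1 npaths_nil.
    move=> s; rewrite inE; apply/eqP/eqP => [-> //|].
    by case: s => [|[x|] [|[y|] s]] //=; case: park_from.
  by apply/hasPn => x; rewrite mem_iota /= inE; lia.
- rewrite /ms /= map_inj_in_uniq ?iota_uniq ?andbT; first by apply/mapP => -[].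
  by move=> i j _ _ /(congr1 (fun s => nth None s 0)) [->].
- by rewrite mem_map ?mem_decr ?ltnn //; exact: Some_inj.
rewrite /ms => s; apply/idP/eqP => [|E].
  rewrite inE => /predU1P[-> // | /mapP[e]]; rewrite mem_iota /= => lt_e ->.
  by rewrite /m /= park_from0_gap (decr_split e) //= map_cat.
rewrite inE; case: s E => [|[e|] s] //=; last by case=> ->; rewrite eqxx.
case E: park_from => [r|] //= [eq_r]; rewrite eq_r in E.
have [u [v [eq_uv ->]]] := park_from0_full E.
have lt_e : e < n by rewrite -mem_decr eq_uv mem_cat mem_head orbT.
apply/mapP; exists e; first by rewrite mem_iota.
have sz : size u = size (behead (wl e)).
  have := congr1 (index e) eq_uv; rewrite {1}(decr_split e) //.
  rewrite !index_cat /= eqxx !addn0.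
  have := rev_uniq (iota 0 n).
  rewrite iota_uniq -/(decr n) {1}eq_uv cat_uniq /=.
  (* [e] occurs only once in [decr n], so its index determines the cut. *)
  case/and3P=> _ + _; rewrite negb_or => /andP[/negPf-> _].
  case: ifP => // /mapP[x _]; lia.
move: eq_uv; rewrite (decr_split e) // => /eqP.
by rewrite eqseq_cat // => /andP[/eqP eq_u /eqP[<-]]; rewrite /m /= -eq_u.
Qed.

(** * Layered permutations and compositions *)

(** One-line notation with letters in [nat]: it frees direct sums of
    permutations from casts between the types ['S_(sumn ms)] and ['S_n]. *)
Definition word (n : nat) (pi : 'S_n) : seq nat :=
  [seq val (pi i) | i <- enum 'I_n].

Lemma size_word n (pi : 'S_n) : size (word pi) = n.
Proof. by rewrite size_map size_enum_ord. Qed.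

Lemma nth_word n (pi : 'S_n) (i : 'I_n) : nth 0 (word pi) i = pi i.
Proof. by rewrite (nth_map i) ?size_enum_ord // nth_ord_enum. Qed.

Lemma word_inj n : injective (@word n).
Proof.
move=> pi rho eq_w; apply/permP => i; apply: val_inj.
by rewrite /= -!nth_word eq_w.
Qed.

Lemma word_dsum p q (s : 'S_p) (t : 'S_q) :
  word (dsum_perm s t) = word s ++ map (addn p) (word t).
Proof.
apply: (@eq_from_nth _ 0) => [|i].
  by rewrite size_cat size_map !size_word.
rewrite size_word => lt_i; rewrite -[i]/(val (Ordinal lt_i)) nth_word permE.
rewrite /dsum_fun; case: splitP => j /= ->; rewrite nth_cat size_word.
  by rewrite ltn_ord nth_word.
by rewrite ltnNge leq_addr /= addKn (nth_map 0) ?size_word // nth_word.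
Qed.

Lemma word_decreasing n : word (decreasing_perm n) = decr n.
Proof.
apply: (@eq_from_nth _ 0) => [|i]; first by rewrite size_word size_decr.
rewrite size_word => lt_i; rewrite -[i]/(val (Ordinal lt_i)) nth_word permE /=.
by rewrite nth_rev ?size_iota // nth_iota //; lia.
Qed.

Lemma word_cast m n (e : m = n) (s : 'S_m) : word (cast_perm e s) = word s.
Proof. by case: n / e; rewrite cast_perm_id. Qed.

Fixpoint layered_word (ms : seq nat) : seq nat :=
  if ms is m :: ms' then decr m ++ map (addn m) (layered_word ms') else [::].

Lemma word_dsum_decreasing ms : word (dsum_decreasing ms) = layered_word ms.
Proof.
elim: ms => [|m ms IHms] /=; last by rewrite word_dsum word_decreasing IHms.
by apply: size0nil; rewrite size_word.
Qed.

(** A layered permutation determines its layers: the first letter gives the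
    length of the first one. *)
Lemma layered_word_inj ms ms' : all (leq 1) ms -> all (leq 1) ms' ->
  layered_word ms = layered_word ms' -> ms = ms'.
Proof.
elim: ms ms' => [|[|m] ms IHms] [|[|m'] ms'] //=; rewrite ?decrS // => pos pos'.
case=> eq_m; rewrite eq_m => /eqP; rewrite eqseq_cat // eqxx /= => /eqP.
by move/(inj_map (@addnI _))/IHms->.
Qed.

(** The fuel [b] makes the recursion structural; any [b >= n] will do. *)
Fixpoint compositions_fuel (b n : nat) : seq (seq nat) :=
  if b is b'.+1 then
    if n is 0 then [:: [::]]
    else [seq i :: c | i <- iota 1 n, c <- compositions_fuel b' (n - i)]
  else [:: [::]].

Definition compositions (n : nat) : seq (seq nat) := compositions_fuel n n.

Lemma mem_compositions_fuel b n c : n <= b ->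
  (c \in compositions_fuel b n) = (sumn c == n) && all (leq 1) c.
Proof.
have sumn0 d : (d \in [:: [::]]) = (sumn d == 0) && all (leq 1) d.
  by rewrite inE; case: d => [|[|i] d] //=; rewrite andbF.
elim: b n c => [|b IHb] [|n] c le_b; rewrite ?sumn0 //.
apply/allpairsPdep/andP => [[i [d [+ + ->]]] | []].
  rewrite mem_iota => i_n; rewrite IHb; last by lia.
  case/andP=> /eqP sum_d pos_d; rewrite /= sum_d pos_d andbT; split; lia.
case: c => [|i c] //= /eqP sum_c /andP[i_gt0 c_pos].
exists i, c; rewrite -[1 :: _]/(iota 1 n.+1) mem_iota IHb; last by lia.
by rewrite c_pos andbT; split=> //; lia.
Qed.

Lemma mem_compositions n c :
  (c \in compositions n) = (sumn c == n) && all (leq 1) c.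
Proof. exact: mem_compositions_fuel. Qed.

Lemma compositions_fuel_uniq b n : uniq (compositions_fuel b n).
Proof.
elim: b n => [|b IHb] [|n] //.
apply: allpairs_uniq_dep => [|i _|]; rewrite ?iota_uniq //.
by move=> [i c] [j d] _ _ /= [-> ->].
Qed.

Lemma compositions_uniq n : uniq (compositions n).
Proof. exact: compositions_fuel_uniq. Qed.

(** The total weight of the compositions of [n], a part [i] having weight
    [f i]. *)
Definition composition_sum (R : pzSemiRingType) (f : nat -> R) (n : nat) : R :=
  (\sum_(c <- compositions n) \prod_(i <- c) f i)%R.

Lemma composition_sum0 (R : pzSemiRingType) (f : nat -> R) :
  composition_sum f 0 = 1%R.
Proof. by rewrite /composition_sum big_seq1 big_nil. Qed.

(** Compositions are sorted by their first part. *)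
Lemma composition_sumS (R : pzSemiRingType) (f : nat -> R) n :
  composition_sum f n.+1 =
    (\sum_(i < n.+1) f i.+1 * composition_sum f (n - i))%R.
Proof.
rewrite /composition_sum.
rewrite [compositions n.+1](_ : _ = [seq i :: c |
  i <- iota 1 n.+1, c <- compositions_fuel n (n.+1 - i)]) //.
rewrite big_allpairs_dep (iotaDl 1 0) big_map big_iota0.
apply: eq_bigr => i _; rewrite subSS big_distrr /=.
have perm_c : perm_eq (compositions_fuel n (n - i)) (compositions (n - i)).
  apply: uniq_perm => [||c]; first exact: compositions_fuel_uniq.
    exact: compositions_uniq.
  by rewrite !mem_compositions_fuel ?leq_subr.
by rewrite (perm_big _ perm_c); apply: eq_bigr => c _; rewrite big_cons.
Qed.

Lemma weight_layered_word k ms : 0 < k ->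
  weight k (layered_word ms) = \prod_(m <- ms) weight k (decr m).
Proof.
move=> k_gt0; elim: ms => [|m ms IHms] /=.
  by rewrite big_nil /weight npaths_nil.
have := @weight_cat k (decr m) (layered_word ms) k_gt0.
rewrite size_decr big_cons IHms => -> //.
by apply/allP => x; rewrite mem_decr.
Qed.

(** * Layered counts as composition sums *)

Lemma park_all_run n k (alpha : n.-tuple 'I_n) :
  park_all k alpha = run k (nseq n None) (enum 'I_n) (map val alpha).
Proof.
rewrite /park_all.
have -> : map val alpha = [seq val (tnth alpha i) | i <- enum 'I_n].
  by rewrite -[in LHS](map_tnth_enum alpha) -map_comp.
elim: (enum _) (nseq _ _) => //= i s IHs st.
case: arrive => [st'|] /=; first exact: IHs.
by elim: s {IHs}.
Qed.

Lemma card_outcome_fiber n k (pi : 'S_n) :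
  #|outcome_fiber k pi| = weight k (word pi).
Proof.
have val_ord_inj := @ord_inj n.
have -> : weight k (word pi) = npaths k (nseq n None) (enum 'I_n)
    [seq Some (pi i) | i <- enum 'I_n].
  rewrite -(npaths_map k _ _ _ val_ord_inj) map_nseq val_enum_ord /weight.
  by rewrite size_word -!map_comp.
rewrite cardE -(size_map (fun alpha : n.-tuple 'I_n => map val alpha)).
apply/perm_size/uniq_perm; last first.
- move=> a; rewrite mem_paths; apply/mapP/eqP => [[alpha + ->]|E].
    by rewrite mem_enum inE => /andP[_ /eqP]; rewrite park_all_run.
  have := mem_paths k (nseq n None) (enum 'I_n)
    [seq Some (pi i) | i <- enum 'I_n] a.
  rewrite E eqxx mem_filter size_nseq size_enum_ord.
  case/andP=> _ /mapP[alpha _ eq_a].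
  exists alpha => //; rewrite mem_enum !inE /has_outcome park_all_run -eq_a E.
  by rewrite eqxx.
- exact: paths_uniq.
rewrite map_inj_uniq ?enum_uniq // => x y eq_xy; apply: val_inj.
exact: (inj_map val_inj).
Qed.

Lemma w0_fiber_count_weight k n : w0_fiber_count k n = weight k (decr n).
Proof.
case: n => [|n]; first by rewrite /weight npaths_nil.
by rewrite /= card_outcome_fiber word_decreasing.
Qed.

Lemma layered_wordP n (pi : 'S_n.+1) :
  layered pi <->
  exists2 ms, ms \in compositions n.+1 & word pi = layered_word ms.
Proof.
split=> [[ms [_ pos [e ->]]] | [ms + eq_w]].
  exists ms; first by rewrite mem_compositions e eqxx.
  by rewrite word_cast word_dsum_decreasing.
rewrite mem_compositions => /andP[/eqP e pos]; exists ms; split=> //.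
  by apply: contra_eq_neq e => ->.
by exists e; apply: word_inj; rewrite eq_w word_cast word_dsum_decreasing.
Qed.

(** Layered permutations correspond to compositions, and the fiber of a direct
    sum of decreasing permutations is a product. *)
Lemma layered_count_compositions k n : 0 < k ->
  layered_count k n = composition_sum (w0_fiber_count k) n.
Proof.
move=> k_gt0; case: n => [|n]; first by rewrite composition_sum0.
rewrite /layered_count /composition_sum.
transitivity (\sum_(w <- map layered_word (compositions n.+1)) weight k w).
  pose L := [seq pi <- enum 'S_n.+1 | `[< layered pi >]].
  transitivity (\sum_(w <- map (@word _) L) weight k w).
    rewrite big_map big_filter big_enum_cond /=.
    by apply: eq_bigr => pi _; exact: card_outcome_fiber.
  apply/perm_big/uniq_perm.
  - by rewrite map_inj_uniq; [rewrite filter_uniq ?enum_uniq | exact: word_inj].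
  - rewrite map_inj_in_uniq ?compositions_uniq // => c d.
    rewrite !mem_compositions => /andP[_ c_pos] /andP[_ d_pos].
    exact: layered_word_inj.
  move=> w; apply/mapP/mapP => [[pi + ->] | [ms ms_n ->]].
    by rewrite mem_filter => /andP[/asboolP/layered_wordP].
  have sum_ms : sumn ms = n.+1.
    by move: ms_n; rewrite mem_compositions => /andP[/eqP].
  pose pi := cast_perm sum_ms (dsum_decreasing ms).
  have eq_w : word pi = layered_word ms.
    by rewrite word_cast word_dsum_decreasing.
  exists pi => //; rewrite mem_filter mem_enum andbT.
  by apply/asboolP/layered_wordP; exists ms.
rewrite big_map; apply: eq_bigr => c _; rewrite weight_layered_word //.
by apply: eq_bigr => i _; rewrite w0_fiber_count_weight.
Qed.

(** * Catalan numbers *)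

Local Open Scope ring_scope.

Lemma catalan_ratio n : n.+2%:R * catalan n.+1 = (4 * n%:R + 2) * catalan n.
Proof.
have bin_ratio : (n.+1 * 'C(n.+1.*2, n.+1) = 2 * n.*2.+1 * 'C(n.*2, n))%N.
  have := mul_bin_diag n.+1.*2 n; have := mul_bin_down n.*2.+1 n.
  rewrite doubleS /= (_ : n.*2.+1 - n = n.+1)%N; last by lia.
  by move=> down diag; apply/eqP; rewrite -(eqn_pmul2l (ltn0Sn n)); nia.
rewrite /catalan mulVKf ?pnatr_eq0 //.
apply: (mulfI (x := n.+1%:R)); first by rewrite pnatr_eq0.
rewrite -[LHS]natrM bin_ratio !natrM mulrCA mulVKf ?pnatr_eq0 //.
by rewrite -(natr1 n.*2) -muln2 natrM; ring.
Qed.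

Lemma catalan0 : catalan 0 = 1.
Proof. by []. Qed.

(** The closed form is shown to satisfy the convolution recurrence by looking
    at [W n], the convolution sum [S n] weighted by [i.+1].  The symmetry
    [i <-> n - i] gives [2 * W n = n.+2 * S n], while [catalan_ratio] applied
    to each term of [W n.+1] but the first gives [W n.+1] from [S n]; together
    they determine [S n.+1] from [S n]. *)
Lemma catalan_convolution n :
  catalan n.+1 = \sum_(i < n.+1) catalan i * catalan (n - i).
Proof.
pose S n := \sum_(i < n.+1) catalan i * catalan (n - i).
pose W n := \sum_(i < n.+1) i.+1%:R * (catalan i * catalan (n - i)).
have W_S m : 2 * W m = m.+2%:R * S m.
  have W_rev : W m =
      \sum_(i < m.+1) (m - i).+1%:R * (catalan i * catalan (m - i)).
    rewrite /W (reindex_inj rev_ord_inj); apply: eq_bigr => i _ /=.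
    by rewrite subSS subKn ?leq_ord // [catalan (m - i) * _]mulrC.
  rewrite mulr_natl mulr2n {2}W_rev -big_split mulr_sumr; apply: eq_bigr => i _.
  rewrite /= -mulrDl -natrD; congr (_%:R * _).
  by have := ltn_ord i; lia.
have W_rec m : W m.+1 = catalan m.+1 + 2 * m.+1%:R * S m.
  rewrite /W big_ord_recl subn0 catalan0 !mul1r; congr (_ + _).
  transitivity (\sum_(i < m.+1) (4 * i%:R + 2) * (catalan i * catalan (m - i))).
    by apply: eq_bigr => i _; rewrite lift0 subSS mulrA catalan_ratio mulrA.
  transitivity (2 * (2 * W m) - 2 * S m); last by rewrite W_S -!natr1; ring.
  rewrite !mulr_sumr -sumrB; apply: eq_bigr => i _.
  by rewrite -natr1; ring.
elim: n => [|n IHn]; first by rewrite big_ord1 subn0.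
apply: (mulfI (x := n.+3%:R)); first by rewrite pnatr_eq0.
rewrite catalan_ratio -/(S n.+1) -W_S W_rec.
rewrite (_ : S n = catalan n.+1); last by rewrite IHn.
by rewrite -!natr1; ring.
Qed.

(** An arrival among [n] cars causes at most [n - 1] bumps, so that the limit
    [k] is not felt. *)
Lemma weight_decr_catalan k n : (0 < k)%N -> (n <= k.+1)%N ->
  (weight k (decr n))%:R = catalan n.
Proof.
move=> k_gt0; elim/ltn_ind: n => -[|n] IHn le_n.
  by rewrite catalan0 /weight npaths_nil.
rewrite weight_decr_rec_large // catalan_convolution natr_sum.
apply: eq_bigr => i _; have := ltn_ord i => le_i.
by rewrite natrM !IHn //; lia.
Qed.

(** * Motzkin numbers *)

(** The subsets of [p + q + 1] elements, sorted by their element of rank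
    [p]. *)
Lemma bin_convolution p q n :
  (\sum_(e < n.+1) 'C(e, p) * 'C(n - e, q) = 'C(n.+1, (p + q).+1))%N.
Proof.
elim: q n => [|q IHq].
  elim=> [|n IHn].
    by rewrite big_ord1 bin0 muln1 addn0 binS bin0n; case: p.
  rewrite big_ord_recr /= subnn bin0 muln1 binS -IHn; congr (_ + _)%N.
    by apply: eq_bigr => e _; rewrite !bin0.
  by rewrite addn0.
elim=> [|n IHn].
  by rewrite big_ord1 muln0 addnS bin_small.
rewrite addnS in IHn *; rewrite big_ord_recr /= subnn muln0 addn0.
rewrite binS -IHn -IHq -big_split.
apply: eq_bigr => e _ /=.
by rewrite subSn ?leq_ord // binS mulnDr addnC.
Qed.

(** A common range of summation for all Motzkin numbers up to a bound. *)
Lemma motzkin_catalan N n : (n < N.*2)%N ->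
  motzkin n = \sum_(l < N) 'C(n, l.*2)%:R * catalan l.
Proof.
move=> lt_n; rewrite /motzkin.
have le_N : (n./2.+1 <= N)%N by lia.
rewrite (big_ord_widen N
  (fun l => l.+1%:R^-1 * 'C(n, l.*2)%:R * 'C(l.*2, l)%:R)) //.
rewrite big_mkcond; apply: eq_bigr => l _; case: ifP => [_|/negbT lt_l].
  by rewrite /catalan mulrCA mulrA.
by rewrite bin_small ?mul0r //; lia.
Qed.

Lemma sum_triangle (N : nat) (F : nat -> nat -> rat) :
  \sum_(l < N) \sum_(i < l.+1) F i (l - i)%N =
    \sum_(i < N) \sum_(j < N - i) F i j.
Proof.
elim: N => [|N IHN]; first by rewrite !big_ord0.
rewrite [LHS]big_ord_recr /= IHN !big_ord_recr /= subSnn big_ord1 subnn addrA.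
congr (_ + _); rewrite -big_split; apply: eq_bigr => i _ /=.
by rewrite subSn ?big_ord_recr // ltnW.
Qed.

(** Both sides become sums of products of two Catalan numbers: Pascal's rule
    and [catalan_convolution] on the left, [bin_convolution] on the right. *)
Lemma motzkin_rec n :
  motzkin n.+1 = motzkin n + \sum_(e < n) motzkin e * motzkin (n.-1 - e).
Proof.
case: n => [|n].
  by rewrite big_ord0 addr0 !(@motzkin_catalan 1) // !big_ord1 !bin0.
pose N := n.+2.
have conv : \sum_(e < n.+1) motzkin e * motzkin (n - e) =
    \sum_(l < N) 'C(n.+1, l.*2.+1)%:R * catalan l.+1.
  pose F a b := 'C(n.+1, (a.*2 + b.*2).+1)%:R * (catalan a * catalan b).
  transitivity (\sum_(a < N) \sum_(b < N) F a b).
    under eq_bigr => e _.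
      rewrite !(@motzkin_catalan N); try by have := ltn_ord e; rewrite /N; lia.
      rewrite big_distrlr; over.
    rewrite exchange_big; apply: eq_bigr => a _ /=.
    rewrite exchange_big; apply: eq_bigr => b _ /=.
    rewrite /F -bin_convolution natr_sum mulr_suml; apply: eq_bigr => e _.
    by rewrite natrM; ring.
  (* The square may be cut down to a triangle: the binomial coefficient in
     [F a b] vanishes when [a + b >= N]. *)
  transitivity (\sum_(a < N) \sum_(b < N - a) F a b).
    apply: eq_bigr => a _.
    rewrite [RHS](big_ord_widen N (F a)) ?leq_subr // [RHS]big_mkcond.
    apply: eq_bigr => b _; case: ifP => // /negbT lt_b.
    have small : (n.+1 < (a.*2 + b.*2).+1)%N
      by move: (a : nat) (b : nat) lt_b; rewrite /N; lia.
    by rewrite /F bin_small ?mul0r.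
  rewrite -sum_triangle; apply: eq_bigr => l _.
  rewrite catalan_convolution mulr_sumr; apply: eq_bigr => i _.
  by rewrite /F -doubleD subnKC // -ltnS.
rewrite conv !(@motzkin_catalan N.+1); try by rewrite /N; lia.
rewrite big_ord_recl [X in _ = X + _]big_ord_recl !bin0 -addrA; congr (_ + _).
rewrite -big_split; apply: eq_bigr => l _ /=.
by rewrite doubleS binS natrD mulrDl.
Qed.

Lemma weight_decr_motzkin n : (weight 1 (decr n))%:R = motzkin n.
Proof.
elim/ltn_ind: n => -[|n] IHn.
  by rewrite (@motzkin_catalan 1) // big_ord1 bin0 /weight npaths_nil.
rewrite weight_decr_rec_one motzkin_rec natrD natr_sum IHn //; congr (_ + _).
apply: eq_bigr => i _; have := ltn_ord i => le_i.
by rewrite natrM !IHn //; lia.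
Qed.

(** * Generating functions *)

Lemma coef_fpsD (R : comUnitRingType) (a b : fps R) n : (a + b) n = a n + b n.
Proof. by []. Qed.

Lemma coef_fpsB (R : comUnitRingType) (a b : fps R) n : (a - b) n = a n - b n.
Proof. by []. Qed.

Lemma coef_fps1 (R : comUnitRingType) n : (1 : fps R) n = (n == 0%N)%:R.
Proof. by []. Qed.

Lemma coef_fpsM (R : comUnitRingType) (a b : fps R) n :
  (a * b) n = \sum_(i < n.+1) a i * b (n - i)%N.
Proof. by []. Qed.

(** The recurrence says that [u = 1 + (f - 1) * u]. *)
Lemma fps_recurrence (R : comUnitRingType) (f u : fps R) :
    f 0%N = 1 -> u 0%N = 1 ->
    (forall n, u n.+1 = \sum_(i < n.+1) f i.+1 * u (n - i)%N) ->
  u = 1 / (2 - f).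
Proof.
move=> f0 u0 uS.
have u_eq : u = 1 + (f - 1) * u.
  apply/fpsP => -[|n]; rewrite !coef_fpsD coef_fps1 coef_fpsM.
    by rewrite big_ord1 coef_fpsB coef_fps1 eqxx f0 u0 subrr mul0r addr0.
  rewrite big_ord_recl coef_fpsB coef_fps1 eqxx f0 subrr mul0r !add0r uS.
  by apply: eq_bigr => i _; rewrite coef_fpsB coef_fps1 lift0 subr0 subSS.
have uV : (2 - f) * u = 1.
  transitivity (u - (f - 1) * u); first by ring.
  by rewrite {1}u_eq addrK.
have unit_f : 2 - f \is a GRing.unit by apply/unitrPr; exists u.
by apply: (mulrI unit_f); rewrite uV mulrCA mul1r divrr.
Qed.

Lemma coef_fps_sum (I : Type) (r : seq I) (F : I -> fps rat) n :
  (\sum_(i <- r) F i) n = \sum_(i <- r) F i n.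
Proof. by elim/big_rec2: _ => // i _ y _ <-. Qed.

Lemma coef_fps_exp_small (g : fps rat) m n : g 0%N = 0 -> (n < m)%N ->
  (g ^+ m) n = 0.
Proof.
move=> g0; elim: m n => // m IHm n lt_n.
rewrite exprS coef_fpsM big1 // => -[[|i] lt_i] _ /=; first by rewrite g0 mul0r.
by rewrite IHm ?mulr0 //; lia.
Qed.

(** With [g = f - 1], the partial sum of the geometric series
    [1 / (1 - g)] up to [g ^+ n] differs from the whole by a multiple of
    [g ^+ n.+1], which has no coefficient of order [n]. *)
Lemma row_sum_convolution_triangle (f : nat -> rat) n : f 0%N = 1 ->
  row_sum (convolution_triangle f) n = (1 / (2 - gen_fun f)) n.
Proof.
move=> f0; pose g := gen_fun (fun j => if j is 0 then 0 else f j).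
have -> : 2 - gen_fun f = 1 - g.
  rewrite (_ : gen_fun f = 1 + g); first by ring.
  by apply/fpsP => -[|j] /=; rewrite ?f0 ?addr0 ?add0r.
have unit_g : 1 - g \is a GRing.unit.
  rewrite -[_ \is a _]/((1 - g) 0%N \is a GRing.unit).
  by rewrite coef_fpsB coef_fps1 subr0 unitr1.
have geometric : \sum_(m < n.+1) g ^+ m = 1 / (1 - g) - 1 / (1 - g) * g ^+ n.+1.
  apply: (mulrI unit_g); rewrite !div1r mulrBr mulVKr // divrr //.
  by rewrite -[1 - g]opprB mulNr -subrX1 opprB.
have := congr1 (fun h : fps rat => h n) geometric; rewrite coef_fps_sum.
rewrite /row_sum /convolution_triangle -/g => ->.
rewrite coef_fpsB [X in _ - X]coef_fpsM big1 ?subr0 // => i _.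
by rewrite coef_fps_exp_small ?mulr0 // ltnS leq_subr.
Qed.

Lemma composition_sum_eq (R : pzSemiRingType) (f g : nat -> R) n :
    (forall i, (i <= n)%N -> f i = g i) ->
  composition_sum f n = composition_sum g n.
Proof.
move=> eq_fg; rewrite /composition_sum !big_seq; apply: eq_bigr => c.
rewrite mem_compositions => /andP[/eqP sum_c _].
rewrite !big_seq; apply: eq_bigr => i i_c; apply: eq_fg.
by rewrite -sum_c sumnE (big_rem i) //= leq_addr.
Qed.

Lemma natr_composition_sum (f : nat -> nat) n :
  (composition_sum f n)%:R = composition_sum (fun i => (f i)%:R : rat) n.
Proof.
rewrite /composition_sum natr_sum; apply: eq_bigr => c _; exact: natr_prod.
Qed.

Lemma gen_fun_composition_sum (f : nat -> rat) : f 0%N = 1 ->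
  gen_fun (composition_sum f) = 1 / (2 - gen_fun f).
Proof.
move=> f0; apply: fps_recurrence => //; first exact: composition_sum0.
exact: composition_sumS.
Qed.

Theorem corollary7 :
  [/\ forall k : nat, (1 <= k)%N ->
        [/\ forall n : nat, (2 <= n)%N ->
              layered_count k n =
                (\sum_(1 <= i < n.+1)
                   w0_fiber_count k i * layered_count k (n - i))%N,
            layered_count k 0 = 1%N,
            layered_count k 1 = 1%N
          & forall n : nat,
              (layered_count k n)%:R =
                row_sum
                  (convolution_triangle (fun j => (w0_fiber_count k j)%:R)) n],
      forall k : nat, (1 <= k)%N ->
        gen_fun (fun n => (layered_count k n)%:R) =
          1 / (2 - gen_fun (fun n => (w0_fiber_count k n)%:R)),
      gen_fun (fun n => (layered_count 1 n)%:R) = 1 / (2 - gen_fun motzkin)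
    & gen_fun (fun n => if (n < 2)%N then 1
                        else (layered_count (n - 1) n)%:R) =
        1 / (2 - gen_fun catalan)].
Proof.
have layeredE k n : (1 <= k)%N -> (layered_count k n)%:R =
    composition_sum (fun j => (w0_fiber_count k j)%:R : rat) n.
  by move=> k_gt0; rewrite layered_count_compositions // natr_composition_sum.
have gen_layered k : (1 <= k)%N -> gen_fun (fun n => (layered_count k n)%:R) =
    1 / (2 - gen_fun (fun n => (w0_fiber_count k n)%:R)).
  move=> k_gt0; rewrite -gen_fun_composition_sum //; congr gen_fun.
  by apply/funext => n; exact: layeredE.
have layeredS k n : (1 <= k)%N -> layered_count k n.+1 =
    (\sum_(1 <= i < n.+2) w0_fiber_count k i * layered_count k (n.+1 - i))%N.
  move=> k_gt0; rewrite layered_count_compositions // composition_sumS.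
  rewrite big_add1 big_mkord; apply: eq_bigr => i _.
  by rewrite subSS layered_count_compositions.
split=> // [k k_gt0||].
- split=> // [[|n] // _| |n]; first exact: layeredS.
    rewrite layeredS // big_nat1 w0_fiber_count_weight muln1.
    by apply/eqP; rewrite -(eqr_nat rat) weight_decr_catalan.
  by rewrite row_sum_convolution_triangle // -gen_layered.
- rewrite gen_layered //; congr (1 / (2 - gen_fun _)); apply/funext => n.
  by rewrite w0_fiber_count_weight weight_decr_motzkin.
rewrite -gen_fun_composition_sum ?catalan0 //; congr gen_fun; apply/funext => n.
case: ltnP => [lt_n|le_n].
  by case: n lt_n => [|[|n]] // _; rewrite ?composition_sum0 // composition_sumS
    big_ord1 composition_sum0.
rewrite layeredE; last by lia.
apply: composition_sum_eq => i le_i; rewrite w0_fiber_count_weight.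
by rewrite weight_decr_catalan //; lia.
Qed.
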